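(* Fix an integer $\Delta \ge 3$. Let $G$ be a connected $n$-vertex graph with minimum degree at least $3$ and maximum degree $\Delta$, and fix $u\in V(G)$. Then $\mathbb{E}(T(G,u)) = O_\Delta(\sqrt{n}\,\log n)$, where $T(G,u)$ is the self-intersection time of the non-backtracking random walk on $G$ started at $u$. That is, there is a constant $C$ depending only on $\Delta$ such that $\mathbb{E}(T(G,u))\le C\sqrt n\,\log n$ for every such $n$, $G$ and $u$.
   Context: Graphs are finite, simple and undirected. For a connected graph $G$ with minimum degree at least $3$, the non-backtracking random walk (NBW) on $G$ from $u\in V(G)$ is the random process $(X_t)_{t\ge 0}$ with $X_0=u$, where $X_1$ is chosen uniformly from the set $N(X_0)$ of neighbours of $X_0$, and, for each $t\ge 2$, $X_t$ is chosen uniformly from $N(X_{t-1})\setminus\{X_{t-2}\}$ (conditionally on the past). The self-intersection time is $T(G,u):=\min\{t\ge 2 : X_t=X_j \text{ for some } j\in\{0,\ldots,t-1\}\}$. *)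

(* Defs.v *)
From mathcomp Require Import all_boot all_order all_algebra.
From mathcomp Require Import all_classical all_reals all_analysis.

Set Implicit Arguments.
Unset Strict Implicit.
Unset Printing Implicit Defensive.

Import Order.TTheory GRing.Theory Num.Theory.

Local Open Scope classical_set_scope.
Local Open Scope ring_scope.

Section Graph.
Variables (V : finType) (e : rel V).

(* The adjacency relation e determines the graph: it has no loops and no
   multiple edges by construction once e is symmetric and irreflexive. *)
Definition simple_graph : Prop := symmetric e /\ irreflexive e.

Definition connected_graph : Prop := forall x y : V, connect e x y.

Definition nbhd (x : V) : {set V} := [set y | e x y]%SET.

Definition degree (x : V) : nat := #|nbhd x|.

Definition max_degree : nat := \max_(x : V) degree x.

End Graph.

Definition uniform_mass (R : realType) (V : finType) (A : {set V}) (y : V) : R :=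
  (y \in A)%:R / #|A|%:R.

Section Walk.
Variables (R : realType) (d : measure_display) (Omega : measurableType d).
Variable (P : probability Omega R).

(* Only meaningful when P B > 0. *)
Definition cond_prob (A B : set Omega) : R := fine (P (A `&` B)) / fine (P B).

Variables (V : finType) (X : nat -> Omega -> V).

(* The event X_0 = x_0, ..., X_(t-1) = x_(t-1). *)
Definition history (x : nat -> V) (t : nat) : set Omega :=
  [set w | forall j, (j < t)%N -> X j w = x j].

Record nonbacktracking_walk (e : rel V) (u : V) : Prop := {
  nbw_measurable : forall t x, measurable [set w | X t w = x];
  nbw_start : P [set w | X 0%N w = u] = 1%E;
  nbw_first_step : forall x y, (0 < P (history x 1))%E ->
    cond_prob [set w | X 1%N w = y] (history x 1)
      = uniform_mass R (nbhd e (x 0%N)) y;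
  nbw_step : forall t x y, (2 <= t)%N -> (0 < P (history x t))%E ->
    cond_prob [set w | X t w = y] (history x t)
      = uniform_mass R (nbhd e (x t.-1) :\ x t.-2)%SET y
}.

(* The minimum is taken in the extended reals, so that it is +oo on
   trajectories without self-intersection (there are none, as V is finite). *)
Definition self_intersection_time (w : Omega) : \bar R :=
  ereal_inf [set (t%:R)%:E | t in
    [set t : nat | (2 <= t)%N /\ exists2 j, (j < t)%N & X t w = X j w]].

(* The library's expectation only covers real-valued functions. *)
Definition expected_self_intersection_time : \bar R :=
  (\int[P]_w self_intersection_time w)%E.

End Walk.

(* Main.v *)
Require Import Defs.
From mathcomp Require Import all_boot all_order all_algebra.
From mathcomp Require Import all_classical all_reals all_analysis.
From mathcomp Require Import measurable_realfun.
From mathcomp Require Import ring lra zify.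

(** The expected time is in fact at most C sqrt n; the factor ln n enters only
    through ln n >= ln 2.

    It suffices to find L = O(sqrt n) and eps > 0 depending only on Delta such
    that a walk started from any directed edge repeats a vertex within L steps
    with probability at least eps ([selfavoid_bound]): cutting the walk into
    blocks of length L then gives E T = O(L / eps) ([selfavoid_sum],
    [expected_time_le]).

    Fix the starting edge a, put L = 5 m + 1 with m of order sqrt n, and suppose
    that the probability delta of a repetition within L steps is tiny.  Run the
    walk for r steps, and from the edge reached run two independent copies Y, Z
    for m steps.

    Few meetings.  If Y and Z separate at a vertex b and later share a vertex x,
    follow Y from b to x and then Z backwards from x to b.  This turns the pair
    into a single walk which traces a lasso, that is, whose first repeated
    vertex is b, and since the weight of a path changes by at most a factor
    Delta under reversal, the probability is preserved up to that factor
    ([reroute_lasso], [split_meet_le]).  A lasso with a cycle of length k comes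
    from at most k choices of x, and k <= 2 m, while the lassos have total
    probability at most delta ([first_repeat], [lasso_at_sum]).  Summing over
    the m or so values of r, the probability that Y and Z meet after separating
    is O(Delta delta) on average over r ([late_meet_at_sum]).  So for most r the
    edge reached is good: from it, two copies are self-avoiding and never meet
    again, except with probability at most 1/16.

    Energy is bounded on good edges.  Let G(a, x) be the expected number of
    visits to x within m steps, and let Phi(a) be the sum of G(a, x)^2 over good
    x, which is the mean of the number I of coincidences, at good edges, of two
    independent walks from a.  Take a good and maximizing Phi.  Then
    E I^2 <= 4 Phi(a)^2, since after a first coincidence at x the expected
    number of further ones is governed by Phi(x) <= Phi(a).  Outside an event of
    probability 1/16 the only coincidences are those of the common initial
    segment of the two walks, whose expected length is at most 2.  Comparing
    both facts forces Phi <= 4 on all good edges ([energy_le4]).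

    Energy must be large.  Most of the walk is spent on good edges, so for most
    r the sum over good x of G(X_r, x) is of order m.  There are at most n Delta
    directed edges, so by the Cauchy-Schwarz inequality the energy is at least
    of order m^2 / (n Delta).  With m^2 > 16 n Delta this contradicts Phi <= 4. *)

Set Implicit Arguments.
Unset Strict Implicit.
Unset Printing Implicit Defensive.

Import Order.TTheory GRing.Theory Num.Theory.

Local Open Scope ring_scope.

(** * Expectations over non-backtracking paths *)

Section Walks.
Variables (R : realType) (V : finType) (e : rel V).
Implicit Types (a b x y : V * V) (v w : V) (s t h : seq V).

(** The state of the walk is the directed edge (previous vertex, current
    vertex), which makes it a Markov chain.  Paths list the vertices visited
    after the current one. *)
Definition step a v : R := uniform_mass R (nbhd e a.2 :\ a.1)%SET v.
Definition advance a v : V * V := (a.2, v).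
Definition endstate a s : V * V := foldl advance a s.

(** Expectation of a functional of the next [m] vertices, computed step by step
    so that no probability space of paths has to be built; the Markov property
    is [expect_cat]. *)
Fixpoint expect (m : nat) a (F : seq V -> R) : R :=
  if m is m'.+1 then \sum_v step a v * expect m' (advance a v) (fun s => F (v :: s))
  else F [::].

(** The support of [expect]: comparisons of functionals only need to be checked
    on these paths. *)
Fixpoint nbpath a s : bool :=
  if s is v :: s' then (v \in (nbhd e a.2 :\ a.1)%SET) && nbpath (advance a v) s'
  else true.

Lemma step_ge0 a v : 0 <= step a v.
Proof. by rewrite /step /uniform_mass divr_ge0 // ler0n. Qed.

Lemma expect_le_nb m a F G :
  (forall s, size s = m -> nbpath a s -> F s <= G s) -> expect m a F <= expect m a G.
Proof.
elim: m a F G => [|m IH] a F G FG /=; first exact: FG.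
apply: ler_sum => v _.
case: (boolP (v \in (nbhd e a.2 :\ a.1)%SET)) => hv; last first.
  by rewrite /step /uniform_mass (negbTE hv) !mul0r.
apply: ler_wpM2l; first exact: step_ge0.
apply: IH => s hs ps; apply: FG; first by rewrite /= hs.
by rewrite /= hv.
Qed.

Lemma expect_le m a F G :
  (forall s, size s = m -> F s <= G s) -> expect m a F <= expect m a G.
Proof. by move=> FG; apply: expect_le_nb => s hs _; exact: FG. Qed.

Lemma expect_eq_nb m a F G :
  (forall s, size s = m -> nbpath a s -> F s = G s) -> expect m a F = expect m a G.
Proof.
by move=> FG; apply/eqP; rewrite eq_le !expect_le_nb // => s hs ps; rewrite FG.
Qed.

Lemma expect_eq m a F G :
  (forall s, size s = m -> F s = G s) -> expect m a F = expect m a G.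
Proof. by move=> FG; apply: expect_eq_nb => s hs _; exact: FG. Qed.

Lemma expectZ m a c F : expect m a (fun s => c * F s) = c * expect m a F.
Proof.
elim: m a F => [//|m IH] a F /=; rewrite big_distrr /=.
by apply: eq_bigr => v _; rewrite IH mulrCA.
Qed.

Lemma expectZr m a c F : expect m a (fun s => F s * c) = expect m a F * c.
Proof. by rewrite mulrC -expectZ; apply: expect_eq => s _; rewrite mulrC. Qed.

Lemma expectD m a F G : expect m a (fun s => F s + G s) = expect m a F + expect m a G.
Proof.
elim: m a F G => [//|m IH] a F G /=; rewrite -big_split /=.
by apply: eq_bigr => v _; rewrite IH mulrDr.
Qed.

Lemma expect0 m a : expect m a (fun=> 0) = 0.
Proof. by elim: m a => [//|m IH] a /=; apply: big1 => v _; rewrite IH mulr0. Qed.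

Lemma expect_sum m a (I : Type) (r : seq I) (P : pred I) (F : I -> seq V -> R) :
  expect m a (fun s => \sum_(i <- r | P i) F i s) = \sum_(i <- r | P i) expect m a (F i).
Proof.
elim: r => [|i r IH].
  rewrite big_nil; apply: etrans (expect0 m a).
  by apply: expect_eq => s _; rewrite big_nil.
rewrite big_cons -IH; case: ifP => Pi; last first.
  by apply: expect_eq => s _; rewrite big_cons Pi.
by rewrite -expectD; apply: expect_eq => s _; rewrite big_cons Pi.
Qed.

Lemma expect_ge0 m a F : (forall s, size s = m -> 0 <= F s) -> 0 <= expect m a F.
Proof. by move=> F0; rewrite -(expect0 m a); apply: expect_le. Qed.

Lemma expect_cat m k a F :
  expect (m + k) a F = expect m a (fun s => expect k (endstate a s) (fun t => F (s ++ t))).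
Proof.
elim: m a F => [//|m IH] a F /=.
by apply: eq_bigr => v _; rewrite IH.
Qed.

Lemma expect1E a F : expect 1 a F = \sum_v step a v * F [:: v].
Proof. by []. Qed.

Hypothesis e_sym : symmetric e.
Variable Delta : nat.
Hypothesis deg3 : forall v, (3 <= degree e v)%N.
Hypothesis degD : forall v, (degree e v <= Delta)%N.

Definition valid a := e a.1 a.2.

Lemma card_next a : (2 <= #|(nbhd e a.2 :\ a.1)%SET|)%N.
Proof.
have := deg3 a.2; rewrite /degree (cardsD1 a.1).
by case: (_ \in _) => /=; lia.
Qed.

(** A vertex of degree at least 3 leaves at least two choices for the next
    step, so two independent copies stay together with probability at most
    one half at each step. *)
Lemma step_le_half a v : step a v <= 2^-1.
Proof.
rewrite /step /uniform_mass; case: (_ \in _); last by rewrite mul0r invr_ge0.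
by rewrite mul1r lef_pV2 ?posrE ?ltr0n ?ler_nat //; have := card_next a; lia.
Qed.

Lemma step_sum a : \sum_v step a v = 1.
Proof.
rewrite /step /uniform_mass -big_distrl /= -natr_sum.
rewrite (_ : (\sum_i _)%N = #|(nbhd e a.2 :\ a.1)%SET|); last first.
  by rewrite -sum1_card [RHS]big_mkcond; apply: eq_bigr => v _; case: (_ \in _).
by rewrite divff // pnatr_eq0; have := card_next a; case: #|_|.
Qed.

Lemma expect_const m a c : expect m a (fun=> c) = c.
Proof.
elim: m a => [//|m IH] a /=.
rewrite (eq_bigr (fun v => step a v * c)); last by move=> v _; rewrite IH.
by rewrite -big_distrl /= step_sum mul1r.
Qed.

Lemma expect_take m k a F : (k <= m)%N -> expect m a (fun s => F (take k s)) = expect k a F.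
Proof.
move=> km; rewrite -(subnKC km) expect_cat; apply: expect_eq => s hs.
rewrite -[RHS](expect_const (m - k) (endstate a s)); apply: expect_eq => t _.
by rewrite take_size_cat.
Qed.

Lemma nbpath_valid a s : valid a -> nbpath a s -> valid (endstate a s).
Proof.
elim: s a => [//|v s IH] a va /= /andP[hv ps]; apply: IH ps.
by rewrite /valid /=; move: hv; rewrite !inE => /andP[].
Qed.

Lemma endstate2 a s : (endstate a s).2 = last a.2 s.
Proof. by elim: s a => [//|v s IH] a; rewrite /= IH. Qed.

Lemma endstate_cat a s t : endstate a (s ++ t) = endstate (endstate a s) t.
Proof. exact: foldl_cat. Qed.

(** * The Green function *)

Definition states a s := a :: scanl advance a s.

Definition green m a x : R := expect m a (fun s => (count_mem x (states a s))%:R).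

Lemma green0 a x : green 0 a x = (a == x)%:R.
Proof. by rewrite /green /= addn0. Qed.

Lemma greenS m a x :
  green m.+1 a x = (a == x)%:R + \sum_v step a v * green m (advance a v) x.
Proof.
rewrite /green -[X in X + _](expect_const m.+1 a) -[X in _ + X]/(expect m.+1 a (fun s =>
  (if s is v :: s' then (count_mem x (states (advance a v) s'))%:R else 0))) -expectD.
by apply: expect_eq => -[//|v s] _; rewrite [in LHS]/= natrD.
Qed.

Lemma green_ge0 m a x : 0 <= green m a x.
Proof. by apply: expect_ge0 => s _; rewrite ler0n. Qed.

Lemma green_leS m a x : green m a x <= green m.+1 a x.
Proof.
elim: m a => [|m IH] a.
  rewrite greenS green0 lerDl; apply: sumr_ge0 => v _.
  by rewrite mulr_ge0 ?step_ge0 ?green_ge0.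
rewrite greenS [leRHS]greenS lerD2l; apply: ler_sum => v _.
by rewrite ler_wpM2l ?step_ge0.
Qed.

(** Of two visited states one is visited first, and the walk restarts from it
    by the Markov property. *)
Lemma green_corr m a x y :
  expect m a (fun s => (count_mem x (states a s))%:R * (count_mem y (states a s))%:R)
  <= green m a x * green m x y + green m a y * green m y x.
Proof.
elim: m a => [|m IH] a.
  rewrite !green0 /= !addn0.
  case: (a =P x) => [<-|_] /=; rewrite ?mul0r ?mul1r ?add0r ?mulr1 ?mulr_ge0 ?ler0n //.
  by rewrite lerDl mulr_ge0 ?ler0n.
have -> : expect m.+1 a (fun s => (count_mem x (states a s))%:R * (count_mem y (states a s))%:R) =
  (a == x)%:R * green m.+1 a y + (a == y)%:R * (\sum_v step a v * green m (advance a v) x) +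
  \sum_v step a v * expect m (advance a v) (fun s => (count_mem x (states (advance a v) s))%:R
     * (count_mem y (states (advance a v) s))%:R).
  rewrite greenS mulrDr -[X in X + _ + _ + _](expect_const m.+1 a) /=.
  rewrite !big_distrr /= -!big_split /=; apply: eq_bigr => v _.
  rewrite /green ![in RHS](mulrCA _ (step a v)) -!mulrDr; congr (_ * _).
  rewrite -!expectZ -!expectD.
  by apply: expect_eq => s _; rewrite !natrD; ring.
set c := \sum_v _ * expect _ _ _.
have hc : c <= \sum_v step a v * (green m (advance a v) x * green m.+1 x y + green m (advance a v) y * green m.+1 y x).
  apply: ler_sum => v _; apply: ler_wpM2l; first exact: step_ge0.
  by apply: le_trans (IH _) _; apply: lerD; rewrite ler_wpM2l ?green_ge0 ?green_leS.
have h1 : (a == x)%:R * green m.+1 a y = (a == x)%:R * green m.+1 x y.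
  by case: (a =P x) => [->//|_]; rewrite !mul0r.
have h2 : (a == y)%:R * (\sum_v step a v * green m (advance a v) x) <= (a == y)%:R * green m.+1 y x.
  case: (a =P y) => [<-|_]; rewrite ?mul0r // !mul1r greenS lerDr ler0n //.
rewrite h1 (greenS m a x) (greenS m a y) !mulrDl.
apply: le_trans (lerD (lerD (lexx _) h2) hc) _.
rewrite (eq_bigr (fun v => step a v * green m (advance a v) x * green m.+1 x y + step a v * green m (advance a v) y * green m.+1 y x)); last first.
  by move=> v _; ring.
rewrite big_split /= -!big_distrl /=; lra.
Qed.

(** * Pairs of independent walks *)

(** Moving together along a common initial segment does not count: it closes no
    cycle, and it has positive probability. *)
Fixpoint meet s t : bool :=
  match s, t with
  | y :: s', z :: t' => if y == z then meet s' t' else has (mem (z :: t')) (y :: s')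
  | _, _ => false
  end.

(** One more than the length of the common initial segment: the common starting
    state counts as a coincidence too. *)
Fixpoint common s t : nat :=
  match s, t with
  | y :: s', z :: t' => if y == z then (common s' t').+1 else 1
  | _, _ => 1
  end.

Lemma expect_common m a : expect m a (fun s => expect m a (fun t => (common s t)%:R)) <= 2.
Proof.
elim: m a => [|m IH] a /=; first lra.
have -> : \sum_v step a v * expect m (advance a v) (fun s => \sum_w step a w *
    expect m (advance a w) (fun t => (if v == w then (common s t).+1 else 1)%:R)) =
  \sum_v step a v * (1 + step a v *
     expect m (advance a v) (fun s => expect m (advance a v) (fun t => (common s t)%:R))).
  apply: eq_bigr => v _; congr (_ * _).
  transitivity (expect m (advance a v) (fun s => 1 + step a v *
       expect m (advance a v) (fun t => (common s t)%:R))); last first.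
    by rewrite expectD expectZ expect_const.
  apply: expect_eq => s _.
  rewrite -[X in _ = X + _](step_sum a) [in RHS](bigD1 v) //= [in LHS](bigD1 v) //= eqxx addrAC; congr (_ + _).
    rewrite -{2}[step a v]mulr1 -mulrDr; congr (_ * _).
    rewrite -[X in _ = X + _](expect_const m (advance a v)) -expectD.
    by apply: expect_eq => t _; rewrite -natr1 addrC.
  apply: eq_bigr => w /negbTE wv; rewrite -[RHS]mulr1; congr (_ * _).
  by rewrite eq_sym wv expect_const.
have : \sum_v step a v * (1 + step a v *
     expect m (advance a v) (fun s => expect m (advance a v) (fun t => (common s t)%:R))) <= \sum_v step a v * 2.
  apply: ler_sum => v _; apply: ler_wpM2l; first exact: step_ge0.
  have := IH (advance a v); have := step_le_half a v; have := step_ge0 a v; nra.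
by rewrite -big_distrl /= step_sum mul1r.
Qed.

Lemma mem_scanl a s x : x \in scanl advance a s -> x.2 \in s.
Proof.
elim: s a => [//|v s IH] a; rewrite /= !inE => /orP[/eqP->|/IH->]; first by rewrite eqxx.
by rewrite orbT.
Qed.

(** For self-avoiding paths that do not meet again, the coincidences are
    exactly the simultaneous ones on the common initial segment. *)
Lemma states_common a s t : size s = size t -> uniq (a.2 :: s) -> uniq (a.2 :: t) -> ~~ meet s t ->
  (\sum_(x <- states a s) count_mem x (states a t) <= common s t)%N.
Proof.
elim: s t a => [|y s IH] [|z t] a //; first by rewrite /= big_seq1 /= eqxx.
move=> [st] /andP[as_ us] /andP[at_ ut] nm.
have out x u : a.2 \notin u -> x \in scanl advance a u -> (a == x) = false.
  move=> au xu; apply/negP => /eqP E; move: (mem_scanl xu); rewrite -E => h.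
  by rewrite h in au.
have [outs outt] := (fun x => out x _ as_, fun x => out x _ at_).
rewrite (_ : states a (y :: s) = a :: states (advance a y) s) //.
rewrite (_ : states a (z :: t) = a :: states (advance a z) t) //.
have cm x T : count_mem x (a :: T) = ((a == x) + count_mem x T)%N by [].
rewrite big_cons cm eqxx (_ : count_mem a _ = 0%N) ?addn0; last first.
  apply/eqP; rewrite -leqn0 leqNgt -has_count; apply/hasPn => x /outt /=.
  by rewrite eq_sym => ->.
rewrite big_seq.
rewrite (eq_bigr (fun x => count_mem x (states (advance a z) t))); last first.
  by move=> x /outs h; rewrite cm h.
rewrite -big_seq; move: nm; rewrite [meet _ _]/= [common _ _]/=; case: (y =P z) => [yz|yz] nm.
  subst z; rewrite add1n ltnS; apply: IH => //.
rewrite big_seq big1 ?addn0 // => x xs.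
apply/eqP; rewrite -leqn0 leqNgt -has_count; apply/hasPn => x' xt /=.
apply/negP => /eqP E; move: nm => /negP; apply; apply/(@hasP _ _ (y :: s)).
by exists x.2; [exact: (@mem_scanl a (y :: s) x xs)|rewrite -E; exact: (@mem_scanl a (z :: t))].
Qed.

(** * Rerouting a meeting into a lasso *)

(** Unweighted sums over vertex sequences, on which reversal of a sequence
    acts as a bijection. *)
Fixpoint path_sum (m : nat) (F : seq V -> R) : R :=
  if m is m'.+1 then \sum_v path_sum m' (fun s => F (v :: s)) else F [::].

Fixpoint weight a s : R :=
  if s is v :: s' then step a v * weight (advance a v) s' else 1.

Lemma weight_ge0 a s : 0 <= weight a s.
Proof. by elim: s a => [//|v s IH] a /=; rewrite mulr_ge0 ?step_ge0. Qed.

Lemma path_sum_le m F G : (forall s, size s = m -> F s <= G s) -> path_sum m F <= path_sum m G.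
Proof.
elim: m F G => [|m IH] F G FG /=; first exact: FG.
by apply: ler_sum => v _; apply: IH => s hs; apply: FG; rewrite /= hs.
Qed.

Lemma path_sum_eq m F G : (forall s, size s = m -> F s = G s) -> path_sum m F = path_sum m G.
Proof. by move=> FG; apply/eqP; rewrite eq_le !path_sum_le // => s hs; rewrite FG. Qed.

Lemma path_sumZ m c F : path_sum m (fun s => c * F s) = c * path_sum m F.
Proof.
elim: m F => [//|m IH] F /=; rewrite big_distrr /=.
by apply: eq_bigr => v _; rewrite IH.
Qed.

Lemma path_sum_rcons m F : path_sum m.+1 F = \sum_v path_sum m (fun s => F (rcons s v)).
Proof.
elim: m F => [//|m IH] F.
transitivity (\sum_w \sum_v path_sum m (fun s => F (w :: rcons s v))); last exact: exchange_big.
by apply: eq_bigr => w _; exact: (IH (fun s => F (w :: s))).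
Qed.

Lemma path_sum_rev m F : path_sum m (fun s => F (rev s)) = path_sum m F.
Proof.
elim: m F => [//|m IH] F; rewrite path_sum_rcons /=.
apply: eq_bigr => v _; rewrite -[RHS]IH.
by apply: path_sum_eq => s _; rewrite rev_rcons.
Qed.

Lemma expect_path_sum m a F : expect m a F = path_sum m (fun s => weight a s * F s).
Proof.
elim: m a F => [|m IH] a F /=; first by rewrite mul1r.
apply: eq_bigr => v _; rewrite IH -path_sumZ.
by apply: path_sum_eq => s _; rewrite mulrA.
Qed.

(** The probability of each allowed step at [v], provided that the walk entered
    [v] along an edge. *)
Definition invd v : R := ((degree e v).-1%:R)^-1.

Lemma stepE a v : valid a -> step a v = (v \in (nbhd e a.2 :\ a.1)%SET)%:R * invd a.2.
Proof.
move=> va; rewrite /step /uniform_mass /invd; congr (_ * (_%:R)^-1).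
rewrite /degree (cardsD1 a.1 (nbhd e a.2)) inE.
by move: va; rewrite /valid e_sym => ->.
Qed.

Lemma weightE a s : valid a ->
  weight a s = (nbpath a s)%:R * \prod_(v <- belast a.2 s) invd v.
Proof.
elim: s a => [|v s IH] a va /=; first by rewrite big_nil mulr1.
rewrite stepE // big_cons; case: (boolP (v \in _)) => hv /=; last by rewrite !mul0r.
rewrite IH ?mul1r; first by rewrite mulrCA.
by move: hv; rewrite !inE => /andP[].
Qed.

Lemma nbpath_path a s : nbpath a s -> path e a.2 s.
Proof.
elim: s a => [//|v s IH] a /=; rewrite !inE => /andP[/andP[_ ->]] /IH.
by [].
Qed.

Lemma uniq_nbpath a s : path e a.2 s -> uniq (a.2 :: s) -> head a.2 s != a.1 -> nbpath a s.
Proof.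
elim: s a => [//|v s IH] a /=; rewrite !inE => /andP[-> ps] /and3P[].
rewrite negb_or => /andP[av as_] vs us ->; apply: IH => //=; first by rewrite vs.
case: s as_ {ps vs us} => [|w s] /=; first by rewrite eq_sym.
by rewrite inE negb_or eq_sym => /andP[].
Qed.

Lemma invd_gt0 v : 0 < invd v.
Proof. by rewrite /invd invr_gt0 ltr0n; have := deg3 v; lia. Qed.

Lemma invd_comp v w : invd v <= Delta%:R * invd w.
Proof.
apply: (@le_trans _ _ 1).
  by rewrite /invd invf_le1 ?ler1n ?ltr0n; have := deg3 v; lia.
rewrite /invd ler_pdivlMr ?ltr0n; last by have := deg3 w; lia.
by rewrite mul1r ler_nat; have := degD w; lia.
Qed.

(** The weight of a path is the product of [invd] over the vertices at which a
    choice is made.  Traversing it backwards exchanges only the first and the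
    last of them, which costs at most a factor [Delta]. *)
Lemma weight_rev a a' s :
  valid a -> valid a' -> uniq (a'.2 :: rcons (rev s) a.2) ->
  head a.2 (rev s) != a'.1 ->
  weight a (rcons s a'.2) <= Delta%:R * weight a' (rcons (rev s) a.2).
Proof.
move=> va va' us hd; rewrite !weightE // !belast_rcons !big_cons.
have -> : \prod_(v <- rev s) invd v = \prod_(v <- s) invd v.
  by apply: perm_big; rewrite perm_rev.
have pos : 0 <= \prod_(v <- s) invd v.
  by apply: prodr_ge0 => v _; exact/ltW/invd_gt0.
case: (boolP (nbpath a _)) => ps; last first.
  by rewrite mul0r !mulr_ge0 ?ler0n //; exact/ltW/invd_gt0.
rewrite uniq_nbpath //.
- rewrite !mul1r mulrA ler_wpM2r //; exact: invd_comp.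
- move: (nbpath_path ps); rewrite (eq_path (e' := fun z => e^~ z)) => [|v w]; last exact: e_sym.
  by rewrite -rev_path last_rcons belast_rcons rev_cons.
- by rewrite headI; case: (rev s) hd.
Qed.

(** The probability that the walk with history [h] makes its first repetition
    by closing a cycle of length [j.+1] at its current vertex. *)
Definition lasso h a j : R :=
  expect j.+1 a (fun s => (uniq (h ++ take j s) && (last a.2 s == a.2))%:R).

(** The second path [t], from the current vertex [a.2] to the last vertex of
    [s], is replaced by its reversal, which continues [s] back to [a.2].  The
    condition on the first vertices ensures that the continuation does not
    backtrack when [s] has length one. *)
Lemma reroute_lasso h a l s :
  valid a -> nbpath a s -> s != [::] -> a.2 \in h ->
  expect l.+1 a (fun t => [&& ohead s != ohead t, last a.2 s == last a.2 t &
     uniq (h ++ s ++ rev (take l t))]%:R) <=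
  Delta%:R * expect l.+1 (endstate a s) (fun t =>
     (uniq (h ++ s ++ take l t) && (last (last a.2 s) t == a.2))%:R).
Proof.
move=> va ps; case: (lastP s) ps => [//|{}s x] ps _ ah.
rewrite !expect_path_sum !path_sum_rcons last_rcons.
rewrite (bigD1 x) //= [X in _ + X]big1 ?addr0; last first.
  move=> z zx; rewrite -[RHS](mul0r (path_sum l (fun=> 0))) -path_sumZ.
  by apply: path_sum_eq => t _; rewrite last_rcons [x == z]eq_sym (negbTE zx) /= andbF mul0r mulr0.
rewrite [X in _ <= _ * X](bigD1 a.2) //= [X in _ * (_ + X)]big1 ?addr0; last first.
  move=> z zx; rewrite -[RHS](mul0r (path_sum l (fun=> 0))) -path_sumZ.
  by apply: path_sum_eq => t _; rewrite last_rcons (negbTE zx) /= andbF mul0r mulr0.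
rewrite -[X in _ <= _ * X]path_sum_rev -path_sumZ; apply: path_sum_le => t st.
have tk (u : seq V) z : size u = l -> take l (rcons u z) = u.
  by move=> <-; rewrite -cats1 take_size_cat.
rewrite !last_rcons !eqxx !tk ?size_rev //= andbT.
case: (boolP (uniq _)) => us; last by rewrite andbF !mulr0.
rewrite andbT mulr1; case: eqP => hd; first by rewrite mulr0 !mulr_ge0 ?ler0n ?weight_ge0.
rewrite mulr1.
have va' : valid (endstate a (rcons s x)) by exact: nbpath_valid.
have e2 : (endstate a (rcons s x)).2 = x by rewrite endstate2 last_rcons.
move: us; rewrite cat_uniq cat_rcons => /and3P[_ /hasPn dis ut].
have a0 : a.2 \notin s ++ x :: rev t by apply/negP => /dis; rewrite /= ah.
move: ut; rewrite cat_uniq => /and3P[us /hasPn ds ux].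
rewrite -{1}e2; apply: weight_rev => //; rewrite ?e2.
  move: a0 ux; rewrite mem_cat inE !negb_or /= rcons_uniq mem_rcons inE negb_or.
  by rewrite eq_sym => /and3P[_ -> ->] /andP[-> ->].
rewrite /endstate -cats1 foldl_cat /= -/(endstate a s) endstate2.
case: (lastP t) a0 ds hd {dis ux tk st} => [|{}t w] a0 ds hd.
  case: s hd a0 {ps va' e2 us ds} => [|y s] //= _; rewrite -cat_cons mem_cat negb_or => /andP[a0 _].
  by apply: contraNneq a0 => ->; exact: mem_last.
rewrite rev_rcons /=; apply: contraTneq (mem_last a.2 s) => <-.
rewrite inE negb_or; apply/andP; split.
  by apply: contraNneq a0 => <-; rewrite rev_rcons mem_cat !inE eqxx !orbT.
by apply: ds; rewrite rev_rcons !inE eqxx orbT.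
Qed.

(** The part of a meeting in which the two copies part at once, so that the
    lasso closes at the current vertex [a.2]. *)
Definition split_meet m h a : R :=
  expect m a (fun s => expect m a (fun t =>
    [&& uniq (h ++ s), uniq (h ++ t), ohead s != ohead t & has (mem t) s]%:R)).

(** [k] is the position on the first path of its first vertex on the second
    one, and [l] is the position of that vertex there; the cycle then has
    length [k + l + 2]. *)
Lemma split_meet_le m h a : valid a -> a.2 \in h ->
  split_meet m h a <= Delta%:R * \sum_(k < m) \sum_(l < m) lasso h a (k + l).+1.
Proof.
move=> va ah.
pose C l s t := [&& ohead s != ohead t, last a.2 s == last a.2 t &
     uniq (h ++ s ++ rev (take l t))] : bool.
apply: (@le_trans _ _ (\sum_(k < m) \sum_(l < m)
    expect k.+1 a (fun s => expect l.+1 a (fun t => (C l s t)%:R)))); last first.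
  rewrite mulr_sumr; apply: ler_sum => k _; rewrite mulr_sumr.
  apply: ler_sum => l _; rewrite /lasso -addSn -addnS expect_cat -expectZ.
  apply: expect_le_nb => s sk ps; apply: le_trans (reroute_lasso _ _ _ _ _) _ => //.
    by case: (s) sk.
  rewrite le_eqVlt; apply/orP; left; apply/eqP; congr (_ * _).
  by apply: expect_eq => t tl; rewrite last_cat take_cat sk ltnNge leq_addr /= ?addKn ?subSS ?addKn.
rewrite (_ : \sum_(k < m) _ = expect m a (fun s => expect m a (fun t =>
    \sum_(k < m) \sum_(l < m) (C l (take k.+1 s) (take l.+1 t))%:R))); last first.
  rewrite (@expect_eq _ _ _ (fun s => \sum_(k < m) \sum_(l < m) expect l.+1 a (fun t => (C l (take k.+1 s) t)%:R))).
    rewrite expect_sum; apply: eq_bigr => k _; rewrite expect_sum; apply: eq_bigr => l _.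
    by rewrite (@expect_take m k.+1 a (fun s => expect l.+1 a (fun t => (C l s t)%:R))).
  move=> s _; rewrite expect_sum; apply: eq_bigr => k _; rewrite expect_sum; apply: eq_bigr => l _.
  by rewrite (@expect_take m l.+1 a (fun t => (C l (take k.+1 s) t)%:R)).
apply: expect_le => s sm; apply: expect_le => t tm.
case: (boolP [&& _, _, _ & _]) => [/and4P[us ut hd hs]|_]; last first.
  by apply: sumr_ge0 => k _; apply: sumr_ge0 => l _; rewrite ler0n.
have := hs; rewrite has_find sm; set k := find _ _ => km.
pose x := nth a.2 s k.
have xt : x \in t by exact: (nth_find a.2 hs).
have := xt; rewrite -index_mem tm; set l := index _ _ => lm.
rewrite (bigD1 (Ordinal km)) //= (bigD1 (Ordinal lm)) //= (_ : C _ _ _ = true).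
  rewrite -addrA lerDl addr_ge0 // sumr_ge0 // => i _; rewrite ?ler0n //.
  by apply: sumr_ge0 => j _; rewrite ler0n.
have xl : nth a.2 t l = x by rewrite nth_index.
have oh (u : seq V) i : size u = m -> ohead (take i.+1 u) = ohead u.
  by case: u => // u0; move: km; rewrite -u0.
rewrite /C !oh // hd (take_nth a.2) ?sm // (take_nth a.2 (n := l)) ?tm // !last_rcons xl eqxx.
rewrite -/x -(cats1 (take l t)) take_size_cat; last by rewrite size_take tm lm.
rewrite catA cat_uniq /=; apply/and3P; split.
- rewrite /x -(take_nth a.2) ?sm //; apply: subseq_uniq us.
  by rewrite cat_subseq // take_subseq.
- apply/hasPn => y; rewrite mem_rev => yl; have yt := mem_take yl.
  rewrite /= mem_cat mem_rcons inE !negb_or; apply/and3P; split.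
  + by move: ut; rewrite cat_uniq => /and3P[_ /hasPn /(_ _ yt)].
  + by apply: contraTneq yl => ->; rewrite in_take // ltnn.
  + apply/negP => yk; have ys := mem_take yk.
    move: yk; rewrite in_take // => /(before_find a.2) /=.
    by rewrite nth_index // yt.
- by rewrite rev_uniq take_uniq //; move: ut; rewrite cat_uniq => /and3P[].
Qed.

(** * Total mass of the lassos *)

Definition selfavoid L a : R := expect L a (fun s => (uniq (a.2 :: s))%:R).

Lemma selfavoidC L a : 1 - selfavoid L a = expect L a (fun s => (~~ uniq (a.2 :: s))%:R).
Proof.
apply/eqP; rewrite subr_eq /selfavoid -expectD -[X in X == _](expect_const L a); apply/eqP.
by apply: expect_eq => s _; case: (uniq _); rewrite ?addr0 ?add0r.
Qed.

(** Self-avoidance of both walks, history [h] included, is part of the event: it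
    makes the rerouted walk a lasso. *)
Definition late_meet m h a : R :=
  expect m a (fun s => expect m a (fun t =>
    [&& uniq (h ++ s), uniq (h ++ t) & meet s t]%:R)).

Lemma late_meet0 h a : late_meet 0 h a = 0.
Proof. by rewrite /late_meet /= !andbF. Qed.

(** Either the copies part at once, or they take a common first step; the
    latter has probability at most one half given the step of the first
    copy. *)
Lemma late_meetS m h a :
  late_meet m.+1 h a <=
  split_meet m.+1 h a + 2^-1 * expect 1 a (fun s => late_meet m (h ++ s) (endstate a s)).
Proof.
have -> : 2^-1 * expect 1 a (fun s => late_meet m (h ++ s) (endstate a s)) =
    \sum_v step a v * (2^-1 * late_meet m (rcons h v) (advance a v)).
  by rewrite -expectZ expect1E; apply: eq_bigr => v _; rewrite /= cats1.
apply: (@le_trans _ _ (split_meet m.+1 h a + expect m.+1 a (fun s => expect m.+1 a (fun t =>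
    [&& uniq (h ++ s), uniq (h ++ t), ohead s == ohead t & meet s t]%:R)))).
  rewrite -expectD; apply: expect_le => s ss; rewrite -expectD; apply: expect_le => t tt.
  rewrite -natrD ler_nat; case: (uniq (h ++ s)) => //; case: (uniq (h ++ t)) => //=.
  case: s ss => // y s ss; case: t tt => // z t tt; rewrite /= -[Some y == Some z]/(y == z).
  case: eqP => _ /=; first by case: (meet _ _).
  by case: (_ || _).
rewrite lerD2l /=; apply: ler_sum => v _; apply: ler_wpM2l; first exact: step_ge0.
rewrite -expectZ; apply: expect_le => s ss.
rewrite (bigD1 v) //= [X in _ + X]big1 ?addr0; last first.
  move=> w wv; rewrite -[RHS](mulr0 (step a w)) -(expect0 m (advance a w)); congr (_ * _).
  apply: expect_eq => t _; rewrite -[Some v == Some w]/(v == w) eq_sym (negbTE wv) /=.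
  by rewrite !andbF.
apply: ler_pM; first exact: step_ge0.
- by apply: expect_ge0 => t _; rewrite ler0n.
- exact: step_le_half.
- by apply: expect_le => t _; rewrite !eqxx /= !cat_rcons.
Qed.

Definition late_meet_at m a r : R :=
  expect r a (fun s => late_meet m (a.2 :: s) (endstate a s)).

Definition lasso_at a r j : R :=
  expect r a (fun s => lasso (a.2 :: s) (endstate a s) j).

Lemma late_meet_atS m k a r : valid a -> (k.+1 <= m)%N ->
  late_meet_at k.+1 a r <=
  Delta%:R * (\sum_(i < m) \sum_(l < m) lasso_at a r (i + l).+1) +
  2^-1 * late_meet_at k a r.+1.
Proof.
move=> va km; rewrite /late_meet_at -(addn1 r) expect_cat -[X in _ + X]expectZ.
have -> : \sum_(i < m) \sum_(l < m) lasso_at a r (i + l).+1 =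
    expect r a (fun s => \sum_(i < m) \sum_(l < m) lasso (a.2 :: s) (endstate a s) (i + l).+1).
  by rewrite expect_sum; apply: eq_bigr => i _; rewrite expect_sum.
rewrite -[X in X + _]expectZ -expectD; apply: expect_le_nb => s sr ps.
apply: le_trans (late_meetS _ _ _) _; apply: lerD; last first.
  rewrite ler_wpM2l ?invr_ge0 //; apply: expect_le => t _.
  by rewrite -endstate_cat cat_cons.
apply: le_trans (split_meet_le _ _ _) _.
- exact: nbpath_valid.
- by rewrite endstate2 mem_last.
rewrite ler_wpM2l ?ler0n //.
have l0 h b j : 0 <= lasso h b j by apply: expect_ge0 => t _; rewrite ler0n.
rewrite -!(big_mkord xpredT (fun i => \sum_(l < _) lasso _ _ (i + l).+1)).
rewrite [leRHS](big_cat_nat _ km) //= -[leLHS]addr0; apply: lerD; last first.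
  by apply: sumr_ge0 => i _; apply: sumr_ge0 => l _.
apply: ler_sum => i _.
rewrite -!(big_mkord xpredT (fun l => lasso _ _ (i + l).+1)).
rewrite [leRHS](big_cat_nat _ km) //= lerDl.
by apply: sumr_ge0 => l _.
Qed.

(** Iterating [late_meet_atS] charges the splits that happen [i] steps after
    time [r] with weight [2 ^ - i], so each handle length is charged at most
    twice in total. *)
Lemma late_meet_at_sum m k a N : valid a -> (k <= m)%N ->
  \sum_(r < N) late_meet_at k a r <=
  2 * (Delta%:R * \sum_(r < N + k) \sum_(i < m) \sum_(l < m) lasso_at a r (i + l).+1).
Proof.
move=> va; elim: k N => [|k IH] N km.
  rewrite big1; last first.
    by move=> r _; rewrite -(expect0 r a); apply: expect_eq => s _; rewrite late_meet0.
  rewrite !mulr_ge0 ?ler0n // !sumr_ge0 // => r _; rewrite !sumr_ge0 // => i _.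
  rewrite !sumr_ge0 // => l _; apply: expect_ge0 => s _; apply: expect_ge0 => t _; by rewrite ler0n.
pose S r := \sum_(i < m) \sum_(l < m) lasso_at a r (i + l).+1.
have S0 r : 0 <= S r.
  rewrite /S sumr_ge0 // => i _.
  rewrite !sumr_ge0 // => l _; apply: expect_ge0 => s _; apply: expect_ge0 => t _; by rewrite ler0n.
have h1 : \sum_(r < N) late_meet_at k.+1 a r <=
    \sum_(r < N) (Delta%:R * S r + 2^-1 * late_meet_at k a r.+1).
  by apply: ler_sum => r _; exact: late_meet_atS.
have h2 : \sum_(r < N) late_meet_at k a r.+1 <= \sum_(r < N.+1) late_meet_at k a r.
  rewrite big_ord_recl lerDr; apply: expect_ge0 => s _; apply: expect_ge0 => t _.
  by apply: expect_ge0 => u _; rewrite ler0n.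
have h3 := IH N.+1 (ltnW km).
have h4 : \sum_(r < N) S r <= \sum_(r < N.+1 + k) S r.
  rewrite -!(big_mkord xpredT S) [leRHS](@big_cat_nat _ _ _ N) //=; last by lia.
  by rewrite lerDl sumr_ge0.
rewrite addnS -addSn; move: h1; rewrite big_split /= -!mulr_sumr -/S.
have := ler_wpM2l (ler0n R Delta) h4.
move: h2 h3; rewrite -/(S _).
set A := Delta%:R * \sum_(r < N.+1 + k) S r.
set B := Delta%:R * \sum_(r < N) S r.
lra.
Qed.

Lemma sum_window (g : nat -> R) (q m L : nat) :
  (forall t : nat, 0 <= g t) -> (q + m <= L)%N -> \sum_(l < m) g (q + l)%N <= \sum_(t < L) g t.
Proof.
move=> g0 qmL; rewrite -(big_mkord xpredT (fun l => g (q + l)%N)) -(big_mkord xpredT g).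
rewrite [leRHS](@big_cat_nat _ _ _ q) //=; last by lia.
rewrite [X in _ <= _ + X](@big_cat_nat _ _ _ (q + m)) //=; last by lia.
rewrite -[X in index_iota X (q + m)]add0n big_addn addKn.
under [X in _ <= _ + (X + _)]eq_bigr do rewrite addnC.
by rewrite addrCA lerDl addr_ge0 // sumr_ge0.
Qed.

Lemma sum_trunc (g : nat -> R) (n N : nat) :
  (forall r : nat, 0 <= g r) -> \sum_(r < N) (r < n)%:R * g r <= \sum_(r < n) g r.
Proof.
move=> g0; case: (leqP N n) => nN.
  apply: le_trans (@sum_window g 0 N n g0 nN); apply: ler_sum => r _.
  by case: (_ < _)%N; rewrite ?mul1r ?mul0r.
rewrite (big_ord_widen N g (ltnW nN)) [leRHS]big_mkcond /=.
by apply: ler_sum => r _; case: (_ < _)%N; rewrite ?mul1r ?mul0r.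
Qed.

Definition closes w0 h (r t : nat) : bool :=
  uniq (take t.+1 h) && (nth w0 h t.+1 == nth w0 h r).

(** The first repetition happens at one time only, and it repeats one earlier
    vertex only: this is why the lassos are disjoint events. *)
Lemma first_repeat w0 h n : (n < size h)%N ->
  (\sum_(t < n) \sum_(r < t.+1) closes w0 h r t = ~~ uniq (take n.+1 h))%N.
Proof.
elim: n => [|n IH] nh.
  by rewrite big_ord0; case: h nh => // x h _; rewrite /= take0.
rewrite big_ord_recr /= IH; last exact: ltnW.
have nh' : (n < size h)%N by exact: ltnW.
rewrite [in RHS](take_nth w0) // rcons_uniq /closes.
case: (boolP (uniq (take n.+1 h))) => u /=; last by rewrite big1 // andbF.
rewrite andbT negbK add0n -count_uniq_mem // -sum1_count [RHS]big_mkcond (big_nth w0) /=.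
rewrite size_takel // big_mkord; apply: eq_bigr => r _.
by rewrite nth_take // eq_sym; case: eqP.
Qed.

Lemma lasso_atE a r j L : (r + j < L)%N ->
  lasso_at a r j = expect L a (fun s => (closes a.2 (a.2 :: s) r (r + j))%:R).
Proof.
move=> rL.
transitivity (expect (r + j.+1) a (fun s => (closes a.2 (a.2 :: s) r (r + j))%:R)); last first.
  rewrite -(@expect_take L) ?addnS //; apply: expect_eq => s sL.
  rewrite /closes -[a.2 :: take (r + j).+1 s]/(take (r + j).+2 (a.2 :: s)).
  by rewrite !nth_take ?take_takel //; lia.
rewrite expect_cat; apply: expect_eq => s sr; apply: expect_eq => t tj.
rewrite /closes endstate2 /= take_cat sr ltnNge leq_addr /= addKn -cat_cons.
have -> : last (last a.2 s) t = nth a.2 (s ++ t) (r + j).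
  rewrite nth_cat sr ltnNge leq_addr /= addKn.
  by case: t tj => //= v t [<-]; rewrite (last_nth a.2).
have -> // : nth a.2 ((a.2 :: s) ++ t) r = last a.2 s.
by rewrite nth_cat [size _]/= sr ltnSn (last_nth a.2) sr.
Qed.

(** For a fixed [i], the lassos in the sum are disjoint events, because [l]
    determines the cycle length; the [m] values of [i] account for the factor
    [m]. *)
Lemma lasso_at_sum a N m L : (N + 2 * m <= L)%N ->
  \sum_(r < N) \sum_(i < m) \sum_(l < m) lasso_at a r (i + l).+1 <=
  m%:R * (1 - selfavoid L a).
Proof.
move=> NL.
pose c s (r t : nat) := closes a.2 (a.2 :: s) r t.
have h1 (r : 'I_N) : \sum_(i < m) \sum_(l < m) lasso_at a r (i + l).+1 <=
    m%:R * expect L a (fun s => \sum_(t < L) ((r <= t)%N && c s r t)%:R).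
  have rN := ltn_ord r.
  rewrite -[m in m%:R]card_ord -sum1_card natr_sum mulr_suml.
  apply: ler_sum => i _; rewrite mul1r.
  have im := ltn_ord i.
  rewrite (eq_bigr (fun l : 'I_m => expect L a (fun s => (c s r (r + (i + l).+1)%N)%:R))); last first.
    by move=> l _; apply: lasso_atE; have := ltn_ord l; lia.
  rewrite -expect_sum; apply: expect_le => s _.
  have := @sum_window (fun t : nat => ((r <= t)%N && c s r t)%:R) (r + i.+1) m L.
  move=> /(_ (fun t : nat => ler0n _ _)) /(_ ltac:(lia)); apply: le_trans.
  apply: ler_sum => l _; rewrite -addnA addSn leq_addr; exact: lexx.
apply: (@le_trans _ _ (\sum_(r < N) m%:R * expect L a (fun s => \sum_(t < L) ((r <= t)%N && c s r t)%:R))).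
  by apply: ler_sum => r _.
rewrite -mulr_sumr ler_wpM2l ?ler0n // selfavoidC -expect_sum.
apply: expect_le => s sL; rewrite exchange_big /=.
have := @first_repeat a.2 (a.2 :: s) L; rewrite take_oversize /= ?sL // => /(_ (leqnn _)) <-.
rewrite natr_sum; apply: ler_sum => i _; rewrite natr_sum.
apply: le_trans (@sum_trunc (fun r => (c s r i)%:R) i.+1 N (fun r => ler0n _ _)).
by apply: ler_sum => r _; rewrite ltnS; case: (_ <= _)%N; rewrite ?mul1r ?mul0r.
Qed.

(** * Energy of good states *)

Lemma selfavoid_anti k L a : (k <= L)%N -> selfavoid L a <= selfavoid k a.
Proof.
move=> kL; rewrite /selfavoid -(@expect_take L k a _ kL); apply: expect_le => s _.
have imp : uniq (a.2 :: s) -> uniq (a.2 :: take k s).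
  by apply: subseq_uniq; rewrite /= eqxx take_subseq.
by case: (boolP (uniq (a.2 :: s))) => [/imp -> //|_]; rewrite ler0n.
Qed.

Definition conflict m a : R :=
  expect m a (fun s => expect m a (fun t =>
    [|| ~~ uniq (a.2 :: s), ~~ uniq (a.2 :: t) | meet s t]%:R)).

(** A conflict of the two copies is a repetition on one of the two walks
    extended by the common past, or else a late meeting of two self-avoiding
    walks. *)
Lemma conflict_at_le L m r a : (r + m <= L)%N ->
  expect r a (fun s => conflict m (endstate a s)) <= 2 * (1 - selfavoid L a) + late_meet_at m a r.
Proof.
move=> rmL; apply: (@le_trans _ _ (2 * (1 - selfavoid (r + m) a) + late_meet_at m a r)); last first.
  by rewrite lerD2r ler_wpM2l // lerB // selfavoid_anti.
rewrite selfavoidC expect_cat -expectZ -expectD; apply: expect_le => s _.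
set b := endstate a s.
pose n u : R := (~~ uniq (a.2 :: s ++ u))%:R.
have h u : ~~ uniq (b.2 :: u) ==> ~~ uniq (a.2 :: s ++ u).
  have -> : a.2 :: s ++ u = belast a.2 s ++ b.2 :: u.
    by rewrite endstate2 -cat_rcons -lastI.
  rewrite cat_uniq.
  by apply/implyP => nu; rewrite (negbTE nu) !andbF.
apply: (@le_trans _ _ (expect m b (fun u => expect m b (fun t => n u + n t +
    [&& uniq ((a.2 :: s) ++ u), uniq ((a.2 :: s) ++ t) & meet u t]%:R)))).
  apply: expect_le => u _; apply: expect_le => t _.
  rewrite /n -!natrD ler_nat -!cat_cons; have := h u; have := h t; rewrite !cat_cons.
  by case: (uniq (b.2 :: u)); case: (uniq (b.2 :: t)); case: (uniq (a.2 :: s ++ u));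
     case: (uniq (a.2 :: s ++ t)); case: meet.
rewrite le_eqVlt; apply/orP; left; apply/eqP.
transitivity (expect m b (fun u => n u + expect m b n +
   expect m b (fun t => [&& uniq ((a.2 :: s) ++ u), uniq ((a.2 :: s) ++ t) & meet u t]%:R))).
  by apply: expect_eq => u _; rewrite !expectD expect_const.
by rewrite !expectD expect_const mulr_natl mulr2n.
Qed.

Definition good m x : bool := valid x && (conflict m x <= 16^-1).

Definition energy m a : R := \sum_(x | good m x) green m a x ^+ 2.

(** By independence the second moment is the sum over [x], [y] of the squared
    correlation of the visits to [x] and [y].  By [green_corr] this is
    controlled by the energy at [a] times that at [x]. *)
Lemma pair_second_moment m a c : good m a ->
  (forall x, good m x -> energy m x <= c) ->
  expect m a (fun s => expect m a (fun t =>
     (\sum_(x | good m x) (count_mem x (states a s))%:R * (count_mem x (states a t))%:R) ^+ 2))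
  <= 4 * c ^+ 2.
Proof.
move=> ga ec.
pose N x s : R := (count_mem x (states a s))%:R.
pose A x y := green m a x * green m x y.
have -> : expect m a (fun s => expect m a (fun t => (\sum_(x | good m x) N x s * N x t) ^+ 2)) =
    \sum_(x | good m x) \sum_(y | good m y) expect m a (fun s => N x s * N y s) ^+ 2.
  transitivity (expect m a (fun s => \sum_(x | good m x) \sum_(y | good m y)
      (N x s * N y s) * expect m a (fun t => N x t * N y t))).
    apply: expect_eq => s _.
    transitivity (expect m a (fun t => \sum_(x | good m x) \sum_(y | good m y)
        (N x s * N y s) * (N x t * N y t))).
      apply: expect_eq => t _; rewrite expr2 mulr_suml; apply: eq_bigr => x _.
      by rewrite mulr_sumr; apply: eq_bigr => y _; rewrite mulrACA.
    rewrite expect_sum; apply: eq_bigr => x _; rewrite expect_sum; apply: eq_bigr => y _.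
    by rewrite expectZ.
  rewrite expect_sum; apply: eq_bigr => x _; rewrite expect_sum; apply: eq_bigr => y _.
  by rewrite expectZr expr2.
have hA : \sum_(x | good m x) \sum_(y | good m y) A x y ^+ 2 <= c ^+ 2.
  apply: (@le_trans _ _ (\sum_(x | good m x) green m a x ^+ 2 * c)).
    apply: ler_sum => x gx; under eq_bigr do rewrite exprMn.
    by rewrite -mulr_sumr ler_wpM2l ?sqr_ge0 // ec.
  rewrite -mulr_suml expr2 ler_wpM2r ?ec //.
  by apply: le_trans (ec _ ga); apply: sumr_ge0 => x _; exact: sqr_ge0.
apply: (@le_trans _ _ (\sum_(x | good m x) \sum_(y | good m y) (2 * A x y ^+ 2 + 2 * A y x ^+ 2))).
  apply: ler_sum => x _; apply: ler_sum => y _.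
  have := green_corr m a x y; rewrite -/(A x y) -/(A y x) -/(N x) -/(N y).
  have : 0 <= expect m a (fun s => N x s * N y s).
    by apply: expect_ge0 => s _; rewrite mulr_ge0 ?ler0n.
  set E := expect _ _ _ => E0 hE.
  have hE2 : E ^+ 2 <= (A x y + A y x) ^+ 2 by rewrite ler_pXn2r // nnegrE; lra.
  apply: le_trans hE2 _; have := sqr_ge0 (A x y - A y x); rewrite sqrrB sqrrD; lra.
under eq_bigr => x _ do rewrite big_split /= -!mulr_sumr.
rewrite big_split /= -!mulr_sumr.
have -> : \sum_(x | good m x) \sum_(y | good m y) A y x ^+ 2 =
   \sum_(x | good m x) \sum_(y | good m y) A x y ^+ 2 by rewrite exchange_big.
lra.
Qed.

(** At a good state [b] of maximal energy [c], the number [I] of coincidences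
    has mean [c] and second moment at most [4 c^2].  If [c] were large, most of
    the mean would come from the conflict event; this has probability at most
    1/16, which is too little for that second moment. *)
Lemma energy_le4 m a : good m a -> energy m a <= 4.
Proof.
move=> ga0; case: (arg_maxP (energy m) ga0) => b gb bmax.
apply: le_trans (bmax _ ga0) _; rewrite leNgt; apply/negP => e4.
set c := energy m b in bmax e4 *.
pose N x s : R := (count_mem x (states b s))%:R.
pose I s t : R := \sum_(x | good m x) N x s * N x t.
pose bd s t : R := [|| ~~ uniq (b.2 :: s), ~~ uniq (b.2 :: t) | meet s t]%:R.
have EI : expect m b (fun s => expect m b (fun t => I s t)) = c.
  transitivity (expect m b (fun s => \sum_(x | good m x) N x s * green m b x)).
    by apply: expect_eq => s _; rewrite expect_sum; apply: eq_bigr => x _; rewrite expectZ.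
  by rewrite expect_sum; apply: eq_bigr => x _; rewrite expectZr expr2.
have EI2 := pair_second_moment gb bmax; rewrite -/c in EI2.
have Ebd : expect m b (fun s => expect m b (fun t => bd s t)) <= 16^-1 by case/andP: gb.
(* On the conflict event, I <= I^2 / (16 c) + 4 c holds because the difference
   of the two sides is (I - 8 c)^2 / (16 c). *)
have pt s t : size s = m -> size t = m ->
    I s t <= (common s t)%:R + (16 * c)^-1 * I s t ^+ 2 + 4 * c * bd s t.
  move=> ss st; have cp : 0 < (16 * c)^-1 by rewrite invr_gt0; lra.
  case: (boolP [|| ~~ uniq (b.2 :: s), ~~ uniq (b.2 :: t) | meet s t]) => hb.
    rewrite /bd hb mulr1 -addrA -[leLHS]add0r lerD ?ler0n //.
    have -> : 4 * c = (16 * c)^-1 * (64 * c ^+ 2) by field; lra.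
    rewrite -mulrDr -(ler_pM2l (x := 16 * c)) ?mulrA ?divff ?mul1r; [|lra|lra].
    have := sqr_ge0 (I s t - 8 * c); nra.
  rewrite /bd (negbTE hb) mulr0 addr0 -[leLHS]addr0.
  apply: lerD; last by rewrite mulr_ge0 ?sqr_ge0 // ltW.
  move: hb; rewrite !negb_or !negbK => /and3P[us ut nm].
  apply: le_trans (_ : (\sum_(x <- states b s) count_mem x (states b t))%N%:R <= _); last first.
    by rewrite ler_nat states_common // ss st.
  rewrite natr_sum.
  apply: le_trans (_ : \sum_x N x s * N x t <= _).
    rewrite /I big_mkcond /=; apply: ler_sum => x _; case: ifP => // _.
    by rewrite mulr_ge0 ?ler0n.
  rewrite le_eqVlt; apply/orP; left; apply/eqP.
  rewrite /N; elim: (states b s) => [|y S IH].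
    by rewrite big_nil big1 // => x _; rewrite mul0r.
  rewrite big_cons -IH /=; under eq_bigr do rewrite natrD mulrDl.
  rewrite big_split /=; congr (_ + _).
  rewrite (bigD1 y) //= eqxx mul1r big1 ?addr0 // => x /negbTE xy.
  by rewrite eq_sym xy mul0r.
have : c <= 2 + (16 * c)^-1 * (4 * c ^+ 2) + 4 * c * 16^-1.
  rewrite -{1}EI.
  apply: le_trans (_ : expect m b (fun s => expect m b (fun t =>
     (common s t)%:R + (16 * c)^-1 * I s t ^+ 2 + 4 * c * bd s t)) <= _).
    by apply: expect_le => s ss; apply: expect_le => t st; exact: pt.
  rewrite (_ : expect m b _ = expect m b (fun s => expect m b (fun t => (common s t)%:R)) +
     (16 * c)^-1 * expect m b (fun s => expect m b (fun t => I s t ^+ 2)) +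
     4 * c * expect m b (fun s => expect m b (fun t => bd s t))); last first.
    by rewrite -!expectZ -!expectD; apply: expect_eq => s _; rewrite -!expectZ -!expectD.
  apply: lerD; first apply: lerD.
  - exact: expect_common.
  - by rewrite ler_wpM2l // invr_ge0; lra.
  - by rewrite ler_wpM2l //; lra.
have -> : (16 * c)^-1 * (4 * c ^+ 2) = c / 4 by field; lra.
lra.
Qed.

(** * Repetition within order sqrt n steps *)

Lemma green_sum_pred m a (P : pred (V * V)) :
  \sum_(x | P x) green m a x = \sum_(i < m.+1) expect i a (fun s => (P (endstate a s))%:R).
Proof.
elim: m a => [|m IH] a.
  rewrite big_ord1 /=; under eq_bigr do rewrite green0.
  case: (boolP (P a)) => Pa.
    rewrite (bigD1 a) //= eqxx big1 ?addr0 // => x /andP[_ /negbTE xa].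
    by rewrite eq_sym xa.
  by rewrite big1 // => x Px; case: eqP => // ax; move: Pa; rewrite ax Px.
under eq_bigr do rewrite greenS.
rewrite big_split big_ord_recl /=; congr (_ + _).
  case: (boolP (P a)) => Pa.
    rewrite (bigD1 a) //= eqxx big1 ?addr0 // => x /andP[_ /negbTE xa].
    by rewrite eq_sym xa.
  by rewrite big1 // => x Px; case: eqP => // ax; move: Pa; rewrite ax Px.
rewrite exchange_big /= [RHS]exchange_big /=; apply: eq_bigr => v _.
by rewrite -mulr_sumr IH mulr_sumr.
Qed.

Lemma card_valid : \sum_(x | valid x) 1 <= (#|V| * Delta)%:R :> R.
Proof.
rewrite (_ : \sum_(x | valid x) 1 = (\sum_(p : V) degree e p)%N%:R).
  by rewrite ler_nat -sum_nat_const; apply: leq_sum => p _.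
rewrite natr_sum (partition_big fst xpredT) //=; apply: eq_bigr => p _.
rewrite /degree -sum1_card natr_sum (reindex (fun q => (p, q))) /=.
  by apply: eq_bigl => q; rewrite /valid /= eqxx andbT inE.
by exists snd => [q|[x y]] //; rewrite inE /= => /andP[_ /eqP <-].
Qed.

(** If repetitions were rare, most of the first [2 m + 1] states would be good,
    so that the Green function would put mass of order [m] on good states.  This
    is incompatible with [energy_le4] when there are fewer than [m^2 / 16]
    directed edges. *)
Lemma selfavoid_bound m a : (0 < m)%N -> valid a -> (16 * (#|V| * Delta) < m ^ 2)%N ->
  selfavoid (5 * m + 1) a <= 1 - (128 * (Delta + 3)%:R)^-1.
Proof.
move=> m0 va hm; set L := (5 * m + 1)%N; rewrite lerBrDr -lerBrDl leNgt.
apply/negP => hd; set d := 1 - selfavoid L a in hd.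
have D0 : 0 < (Delta + 3)%:R :> R by rewrite ltr0n addn3.
have hd' : d * (128 * (Delta + 3)%:R) < 1 by rewrite -ltr_pdivlMr ?mulr_gt0 // div1r.
have d0 : 0 <= d by rewrite /d selfavoidC; apply: expect_ge0 => s _; rewrite ler0n.
have m0R : 1 <= m%:R :> R by rewrite ler1n.
pose q r := expect r a (fun s => (~~ good m (endstate a s))%:R).
have q0 r : 0 <= q r by apply: expect_ge0 => s _; rewrite ler0n.
pose B := \sum_(r < 2 * m + 1) q r.
(* The expected number B of states that are not good, by Markov's inequality. *)
have hB : B <= m%:R / 4.
  have hb : \sum_(r < 2 * m + 1) expect r a (fun s => conflict m (endstate a s)) <=
      (2 * m + 1)%:R * (2 * d) + 2 * (Delta%:R * (m%:R * d)).
    apply: (@le_trans _ _ (\sum_(r < 2 * m + 1) (2 * d + late_meet_at m a r))).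
      by apply: ler_sum => r _; apply: conflict_at_le; have := ltn_ord r; rewrite /L; lia.
    rewrite big_split /= sumr_const card_ord -[X in X + _ <= _]mulr_natl lerD2l.
    apply: le_trans (late_meet_at_sum _ va (leqnn m)) _.
    rewrite ler_wpM2l // ler_wpM2l ?ler0n //.
    by apply: lasso_at_sum; rewrite /L; lia.
  have hq : B <= 16 * \sum_(r < 2 * m + 1) expect r a (fun s => conflict m (endstate a s)).
    rewrite mulr_sumr; apply: ler_sum => r _; rewrite -expectZ.
    apply: expect_le_nb => s sr ps; rewrite /good nbpath_valid //=.
    have b0 : 0 <= conflict m (endstate a s).
      by apply: expect_ge0 => u _; apply: expect_ge0 => t _; rewrite ler0n.
    by case: (leP (conflict _ _) 16^-1) => /= hbd; lra.
  move: hb hq hd'; rewrite !natrD; set X := \sum_(r < _) _.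
  set D := Delta%:R; set M := m%:R in m0R *.
  have D0' : 0 <= D by rewrite /D ler0n.
  have Md : 0 <= M * d by rewrite mulr_ge0 //; lra.
  move=> hb hq hd'.
  have : M * (d * (128 * (D + 3))) <= M * 1 by rewrite ler_wpM2l ?ltW //; lra.
  have : d <= M * d by rewrite ler_peMl.
  nra.
pose S := \sum_(r < m) expect r a (fun s => (good m (endstate a s))%:R *
   \sum_(y | good m y) green m (endstate a s) y).
have upper : S <= m%:R * (m%:R / 4 + 4 / m%:R * (#|V| * Delta)%:R).
  rewrite mulr_natl -[X in _ <= _ *+ X]card_ord -sumr_const; apply: ler_sum => r _.
  rewrite -[leRHS](expect_const r a); apply: expect_le => s _; set b := endstate a s.
  have c0 : 0 <= m%:R / 4 + 4 / m%:R * (#|V| * Delta)%:R :> R.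
    by rewrite addr_ge0 ?mulr_ge0 ?divr_ge0 ?invr_ge0 ?ler0n //; lra.
  case: (boolP (good m b)) => gb; last by rewrite mul0r.
  rewrite mul1r.
  (* Cauchy-Schwarz in the form g <= (m / 16) g^2 + 4 / m; the weight m / 16
     turns the bound 4 on the energy into m / 4, half of the lower bound m / 2
     per value of r. *)
  apply: (@le_trans _ _ (\sum_(y | good m y) (m%:R / 16 * green m b y ^+ 2 + 4 / m%:R * 1))).
    apply: ler_sum => y _; rewrite mulr1.
    set g := green m b y; set M := m%:R in m0R *.
    have MM : 0 < 16 * M by lra.
    rewrite -(ler_pM2l MM) mulrDr.
    have -> : 16 * M * (M / 16 * g ^+ 2) = (M * g) ^+ 2 by field.
    have -> : 16 * M * (4 / M) = 64 by field; lra.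
    have := sqr_ge0 (M * g - 8); rewrite sqrrB; lra.
  rewrite big_split /= -!mulr_sumr; apply: lerD.
    have := energy_le4 gb; rewrite -/(energy m b) => h4.
    have : m%:R / 16 * energy m b <= m%:R / 16 * 4 by rewrite ler_wpM2l // divr_ge0 ?ler0n.
    lra.
  rewrite ler_wpM2l ?divr_ge0 ?ler0n //; apply: le_trans card_valid.
  rewrite big_mkcond [leRHS]big_mkcond /=; apply: ler_sum => x _.
  by rewrite /good; case: (valid x) => //=; case: ifP.
have lower : m%:R * (m%:R + 1) - (2 * m%:R + 1) * B <= S.
  have h1 : \sum_(r < m) (m%:R + 1 - ((m%:R + 1) * q r + \sum_(i < m.+1) q (r + i)%N)) <= S.
    apply: ler_sum => r _.
    have -> : \sum_(i < m.+1) q (r + i)%N =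
       expect r a (fun s => \sum_(y | ~~ good m y) green m (endstate a s) y).
      transitivity (\sum_(i < m.+1) expect r a (fun s => expect i (endstate a s) (fun t =>
          (~~ good m (endstate (endstate a s) t))%:R))).
        apply: eq_bigr => i _; rewrite /q expect_cat; apply: expect_eq => s _.
        by apply: expect_eq => t _; rewrite endstate_cat.
      rewrite -expect_sum; apply: expect_eq => s _; by rewrite green_sum_pred.
    rewrite -[X in X - _](expect_const r a) /q -expectZ -expectD -[- expect _ _ _]mulN1r -expectZ -expectD.
    apply: expect_le => s _; set b := endstate a s.
    have tot : \sum_(y | good m y) green m b y + \sum_(y | ~~ good m y) green m b y = m%:R + 1.
      transitivity (\sum_(y : V * V) green m b y); first by rewrite [RHS](bigID (good m)).
      rewrite (green_sum_pred m b xpredT).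
      under eq_bigr do rewrite expect_const.
      by rewrite sumr_const card_ord -natr1.
    have n0 : 0 <= \sum_(y | ~~ good m y) green m b y.
      by apply: sumr_ge0 => y _; exact: green_ge0.
    by case: (good m b); rewrite /= ?mulr1 ?mulr0; lra.
  apply: le_trans h1; rewrite big_split /= sumr_const card_ord -[X in _ <= X + _]mulr_natl lerD2l.
  rewrite sumrN lerN2 big_split /= -mulr_sumr.
  have w1 : \sum_(r < m) q r <= B by apply: (@sum_window q 0 m (2 * m + 1) q0); lia.
  have w2 : \sum_(r < m) \sum_(i < m.+1) q (r + i)%N <= m%:R * B.
    rewrite mulr_natl -[X in _ <= _ *+ X]card_ord -sumr_const; apply: ler_sum => r _.
    by apply: (@sum_window q r m.+1 (2 * m + 1) q0); have := ltn_ord r; lia.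
  have m1 : 0 <= m%:R + 1 :> R by lra.
  have w3 := ler_wpM2l m1 w1.
  apply: le_trans (lerD w3 w2) _; rewrite le_eqVlt; apply/orP; left; apply/eqP; ring.
move: hm; rewrite -(ltr_nat R) natrX natrM => hm.
move: upper hm; set n := (#|V| * Delta)%:R; set M := m%:R in m0R hB lower *.
have -> : M * (M / 4 + 4 / M * n) = M ^+ 2 / 4 + 4 * n by field; lra.
move=> upper hm.
have : (2 * M + 1) * B <= (2 * M + 1) * (M / 4) by rewrite ler_wpM2l //; lra.
nra.
Qed.

Lemma selfavoid_le1 k a : selfavoid k a <= 1.
Proof.
by rewrite -[leRHS](expect_const k a); apply: expect_le => s _; case: (uniq _); rewrite ?ler01.
Qed.

Lemma selfavoid_ge0 k a : 0 <= selfavoid k a.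
Proof. by apply: expect_ge0 => s _; rewrite ler0n. Qed.

Lemma selfavoid_add L k a :
  selfavoid (L + k) a <= expect L a (fun s => (uniq (a.2 :: s))%:R * selfavoid k (endstate a s)).
Proof.
rewrite /selfavoid expect_cat; apply: expect_le => s _; rewrite -expectZ; apply: expect_le => t _.
rewrite -natrM ler_nat endstate2.
have -> : a.2 :: s ++ t = belast a.2 s ++ last a.2 s :: t by rewrite -cat_rcons -lastI.
case: (boolP (uniq _)) => // h.
have -> : uniq (a.2 :: s).
  by move: h; rewrite -cat_rcons -lastI cat_uniq => /and3P[].
by move: h; rewrite cat_uniq => /and3P[_ _ ->].
Qed.

(** Survival over [L + k] steps requires survival over [L] steps and then over
    [k] more steps from the state reached.  So the sum [S] of the survival
    probabilities satisfies [S <= L + (1 - eps) S]. *)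
Lemma selfavoid_sum L eps a N : (0 < L)%N -> 0 < eps ->
  (forall b, valid b -> selfavoid L b <= 1 - eps) -> valid a ->
  \sum_(k < N) selfavoid k a <= L%:R / eps.
Proof.
move=> L0 eps0 hL va.
have : \sum_(k < N * L) selfavoid k a <= L%:R / eps.
  elim: N a va => [|K IH] a va; first by rewrite mul0n big_ord0 divr_ge0 ?ler0n ?ltW.
  rewrite mulSn big_split_ord /=.
  have h1 : \sum_(k < L) selfavoid k a <= L%:R.
    rewrite -[leRHS]mulr1 mulr_natl -[X in _ <= _ *+ X]card_ord -sumr_const.
    by apply: ler_sum => k _; exact: selfavoid_le1.
  have h2 : \sum_(k < K * L) selfavoid (L + k) a <= (1 - eps) * (L%:R / eps).
    apply: (@le_trans _ _ (selfavoid L a * (L%:R / eps))); last first.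
      by rewrite ler_wpM2r ?hL // divr_ge0 ?ler0n ?ltW.
    apply: (@le_trans _ _ (expect L a (fun s => (uniq (a.2 :: s))%:R *
        \sum_(k < K * L) selfavoid k (endstate a s)))).
      under [X in _ <= expect _ _ X]eq_fun do rewrite mulr_sumr.
      by rewrite expect_sum; apply: ler_sum => k _; exact: selfavoid_add.
    rewrite -expectZr; apply: expect_le_nb => s _ ps; rewrite ler_wpM2l ?ler0n //.
    by apply: IH; exact: nbpath_valid.
  apply: le_trans (lerD h1 h2) _.
  by rewrite le_eqVlt; apply/orP; left; apply/eqP; field; lra.
apply: le_trans; apply: (@sum_window (selfavoid^~ a) 0 N); last by rewrite leq_pmulr.
by move=> k; exact: selfavoid_ge0.
Qed.

End Walks.

(** * The law of the process *)

Section Law.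
Variables (R : realType) (V : finType) (e : rel V) (u : V).
Variables (d : measure_display) (Omega : measurableType d).
Variables (P : probability Omega R) (X : nat -> Omega -> V).
Hypothesis nbw : nonbacktracking_walk P X e u.
Local Open Scope classical_set_scope.

Definition pr (A : set Omega) : R := fine (P A).

Lemma prE A : measurable A -> (pr A)%:E = P A.
Proof. by move=> mA; rewrite /pr fineK // fin_num_measure. Qed.

Lemma pr_ge0 A : 0 <= pr A.
Proof. exact: fine_ge0. Qed.

Lemma pr_le A B : measurable A -> measurable B -> A `<=` B -> pr A <= pr B.
Proof. by move=> mA mB AB; rewrite -lee_fin !prE // le_measure ?inE. Qed.

Definition cyl (s : seq V) : set Omega := history X (nth u s) (size s).

Lemma cyl_rcons s y : cyl (rcons s y) = [set w | X (size s) w = y] `&` cyl s.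
Proof.
apply/seteqP; split=> w; rewrite /cyl /history /= size_rcons.
  move=> h; split; first by rewrite h // nth_rcons ltnn eqxx.
  by move=> j js; rewrite h; [rewrite nth_rcons js|exact: ltnW].
move=> [h1 h2] j; rewrite ltnS nth_rcons leq_eqVlt => /predU1P[->|js].
  by rewrite ltnn eqxx.
by rewrite js h2.
Qed.

Lemma measurable_cyl s : measurable (cyl s).
Proof.
elim/last_ind: s => [|s y IH].
  by rewrite (_ : cyl [::] = setT) //; apply/seteqP; split.
by rewrite cyl_rcons; apply: measurableI => //; exact: (nbw_measurable nbw).
Qed.

Lemma pr_split A n : measurable A ->
  pr A = \sum_(y : V) pr (A `&` [set w | X n w = y]).
Proof.
move=> mA.
have mX y : measurable [set w | X n w = y] by exact: (nbw_measurable nbw).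
have aux (s : seq V) : uniq s -> pr (A `&` [set w | X n w \in s]) =
    \sum_(y <- s) pr (A `&` [set w | X n w = y]) /\ measurable [set w | X n w \in s].
  elim: s => [_|y s IH /= /andP[ys us]].
    have -> : [set w | X n w \in [::]] = set0 by apply/seteqP; split.
    by rewrite setI0 big_nil /pr measure0.
  have [IH1 IH2] := IH us.
  have E : [set w | X n w \in y :: s] = [set w | X n w = y] `|` [set w | X n w \in s].
    apply/seteqP; split=> w /=; rewrite inE.
      by move=> /orP[/eqP->|]; [left|right].
    by move=> [->|->]; rewrite ?eqxx ?orbT.
  split; last by rewrite E; exact: measurableU.
  rewrite big_cons -IH1; apply: EFin_inj; rewrite EFinD !prE; last 3 first.
  - exact: measurableI.
  - exact: measurableI.
  - by apply: measurableI => //; rewrite E; exact: measurableU.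
  rewrite E setIUr measureU //; [exact: measurableI|exact: measurableI|].
  apply/seteqP; split=> // w [[_ /= Xy] [_ /= Xs]].
  by move: ys; rewrite -Xy Xs.
have [h _] := aux _ (enum_uniq V).
have -> : \sum_y pr (A `&` [set w | X n w = y]) = \sum_(y <- enum V) pr (A `&` [set w | X n w = y]).
  by rewrite big_enum; apply: eq_bigl.
rewrite -h; congr pr.
 apply/seteqP; split=> [w Aw|w [] //].
by split=> //=; rewrite mem_enum.
Qed.

(** The events fixing the next [m] vertices form a finite partition. *)
Lemma pr_path_sum A m s : measurable A ->
  pr (cyl s `&` A) = path_sum m (fun t => pr (cyl (s ++ t) `&` A)).
Proof.
move=> mA; elim: m s => [|m IH] s /=; first by rewrite cats0.
rewrite (pr_split (size s)); last by apply: measurableI => //; exact: measurable_cyl.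
apply: eq_bigr => y _; rewrite setIAC [cyl s `&` _]setIC -cyl_rcons IH.
by apply: path_sum_eq => t _; rewrite cat_rcons.
Qed.

Lemma pr_cyl1 : pr (cyl [:: u]) = 1.
Proof.
rewrite /pr (_ : cyl [:: u] = [set w | X 0 w = u]) ?(nbw_start nbw) //.
rewrite -[[:: u]]/(rcons [::] u) cyl_rcons /= (_ : cyl [::] = setT) ?setIT //.
by apply/seteqP; split.
Qed.

Lemma weight_rcons a s v : weight R e a (rcons s v) =
  weight R e a s * step R e (endstate a s) v.
Proof. by elim: s a => [|w s IH] a /=; rewrite ?mulr1 ?mul1r // IH mulrA. Qed.

Lemma endstate_nth (v : V) s : endstate (u, v) s =
  (nth u [:: u, v & s] (size s), nth u [:: u, v & s] (size s).+1).
Proof.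
elim/last_ind: s => [//|s y IH].
rewrite /endstate -cats1 foldl_cat /= -/(endstate _ s) /advance IH /= size_cat addn1 /=.
congr (_, _); last by rewrite nth_cat ltnn subnn.
rewrite -[v :: s ++ [:: y]]/((v :: s) ++ [:: y]) nth_cat /=.
by rewrite ltnSn.
Qed.

(** The hypothesis on the conditional probability is available only for
    events of positive probability; otherwise both sides vanish. *)
Lemma pr_cond_step s y q :
  ((0 < P (cyl s))%E -> cond_prob P [set w | X (size s) w = y] (cyl s) = q) ->
  pr (cyl (rcons s y)) = pr (cyl s) * q.
Proof.
have ms := measurable_cyl s; have msy := measurable_cyl (rcons s y).
have : 0 <= pr (cyl s) by exact: pr_ge0.
rewrite le_eqVlt => /predU1P[z|pos] h.
  rewrite -z mul0r; apply/eqP; rewrite eq_le pr_ge0 andbT [leRHS]z.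
  by apply: pr_le => //; rewrite cyl_rcons; exact: subIsetr.
rewrite -h; last by rewrite -prE ?lte_fin.
rewrite /cond_prob -cyl_rcons -/(pr _) -/(pr _) mulrC divfK //.
by rewrite gt_eqF.
Qed.

Lemma pr_cyl v s :
  pr (cyl [:: u, v & s]) = uniform_mass R (nbhd e u) v * weight R e (u, v) s.
Proof.
elim/last_ind: s => [|s y IH].
  rewrite mulr1 -[[:: u; v]]/(rcons [:: u] v) (@pr_cond_step _ _ (uniform_mass R (nbhd e u) v)).
    by rewrite pr_cyl1 mul1r.
  by move=> pos; rewrite (nbw_first_step nbw).
rewrite -[[:: u, v & rcons s y]]/(rcons [:: u, v & s] y).
rewrite (@pr_cond_step _ _ (step R e (endstate (u, v) s) y)).
  by rewrite IH weight_rcons mulrA.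
by move=> pos; rewrite (nbw_step nbw) // endstate_nth.
Qed.

(** The event that the self-intersection time exceeds [n], written so that a
    coincidence of [X 0] and [X 1] is ignored, as it is in that time. *)
Definition no_return (n : nat) : set Omega :=
  [set w | forall i j : nat, (i < j)%N -> (2 <= j <= n)%N -> X j w <> X i w].

Lemma measurable_no_return n : measurable (no_return n).
Proof.
have mX k y : measurable [set w | X k w = y] by exact: (nbw_measurable nbw).
have mE i j : measurable [set w | X j w = X i w].
  have -> : [set w | X j w = X i w] = \bigcup_(y in [set: V]) ([set w | X j w = y] `&` [set w | X i w = y]).
    apply/seteqP; split=> w /=; first by move=> h; exists (X i w).
    by move=> [y _ [/= -> ->]].
  by apply: fin_bigcup_measurable => // y _; exact: measurableI.
have -> : no_return n = \bigcap_i \bigcap_(j in [set j : nat | (i < j)%N /\ (2 <= j <= n)%N]) ~` [set w | X j w = X i w].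
  apply/seteqP; split=> w h i.
    by move=> _ j [/= ij jn]; exact: h.
  by move=> j ij jn; apply: (h i I j); split.
apply: bigcap_measurableType => i _; apply: bigcap_measurableType => j _.
exact: measurableC.
Qed.

(** From time 1 on the process is the edge-state walk started from
    [(u, X 1)]. *)
Lemma pr_no_return k : pr (no_return k.+1) <=
  \sum_v uniform_mass R (nbhd e u) v * selfavoid R e k (u, v).
Proof.
have mN := measurable_no_return k.+1.
have mc := measurable_cyl [:: u].
apply: (@le_trans _ _ (pr (cyl [:: u] `&` no_return k.+1))).
  rewrite -lee_fin !prE //; last exact: measurableI.
  rewrite -[X in (_ <= X)%E]adde0.
  have -> : 0%E = P (~` cyl [:: u]).
    by rewrite probability_setC // -prE // pr_cyl1 subee.
  have E : no_return k.+1 = (cyl [:: u] `&` no_return k.+1) `|` (no_return k.+1 `&` ~` cyl [:: u]).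
    by rewrite [cyl _ `&` _]setIC -setIUr setUv setIT.
  rewrite {1}E measureU.
  - rewrite leeD2l // le_measure ?inE //.
      by apply: measurableI => //; exact: measurableC.
    exact: measurableC.
  - exact: measurableI.
  - by apply: measurableI => //; exact: measurableC.
  - by apply/seteqP; split=> // w [[cw _] [_ ncw]].
rewrite (@pr_path_sum _ k.+1) //=; apply: ler_sum => v _.
rewrite /selfavoid expect_path_sum -path_sumZ; apply: path_sum_le => s sk.
rewrite mulrA -pr_cyl /=.
case: (boolP ((v \notin s) && uniq s)) => us; rewrite ?mulr1 ?mulr0.
  apply: pr_le; [|exact: measurable_cyl|exact: subIsetl].
  by apply: measurableI => //; exact: measurable_cyl.
rewrite (_ : _ `&` _ = set0); first by rewrite /pr measure0.
apply/seteqP; split=> // w [cw nw].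
have /(uniqPn u)[i [j [ij js E]]] : ~~ uniq (v :: s) by [].
apply: (nw i.+1 j.+1) => //; first by rewrite /= ltnS; move: js => /=; rewrite sk; lia.
have js' : (j < (size s).+1)%N by [].
by rewrite (cw j.+1) ?(cw i.+1) //=; lia.
Qed.

(** Pigeonhole principle on the vertices at times [1] to [#|V| + 1]. *)
Lemma hit_exists w : exists n, (2 <= n)%N && [exists j : 'I_n, X n w == X j w] && (n <= #|V|.+1)%N.
Proof.
pose f (i : 'I_(#|V|.+1)) := X i.+1 w.
have : ~~ injectiveb f.
  by apply/negP => /injectiveP /leq_card; rewrite card_ord ltnn.
move/injectivePn => [i [j ij E]].
wlog lt : i j ij E / (i < j)%N.
  move=> h; case: (ltngtP i j) => c; [exact: (h i j)|apply: (h j i) => //; by rewrite eq_sym|].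
  by move: ij; rewrite (val_inj c) eqxx.
have jb := ltn_ord j.
exists j.+1; rewrite [(j.+1 <= _)%N]jb andbT; apply/andP; split; first by lia.
have ij' : (i.+1 < j.+1)%N by [].
by apply/existsP; exists (Ordinal ij'); rewrite /= -[X j.+1 w]/(f j) -[X i.+1 w]/(f i) E.
Qed.

(** The time is finite by [hit_exists], so it is a finite sum of tail
    indicators; this also makes it measurable. *)
Lemma time_sum w :
  self_intersection_time R X w = (\sum_(n < #|V|.+2) \1_(no_return n) w)%:E.
Proof.
have [n0 /andP[/andP[n02 hit] n0V] nmin] := ex_minnP (hit_exists w).
have [j0 /eqP E0] := existsP hit.
have nh n : (w \in no_return n) = (n < n0)%N.
  apply/idP/idP; rewrite inE.
    move=> h; rewrite ltnNge; apply/negP => n0n.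
    by apply: (h j0 n0) => //; rewrite n02.
  move=> nn0 i j ij /andP[j2 jn] E.
  suff : (n0 <= j)%N by lia.
  apply: nmin; rewrite j2 /=; apply/andP; split; last exact: leq_trans jn (leq_trans (ltnW nn0) n0V).
  by apply/existsP; exists (Ordinal ij); rewrite /= E.
transitivity (n0%:R%:E : \bar R).
  apply/eqP; rewrite eq_le; apply/andP; split.
    by apply: ereal_inf_lbound; exists n0 => //; split=> //; exists j0.
  apply: le_ereal_inf_tmp => _ [n [n2 [j jn E]] <-].
  rewrite lee_fin ler_nat; case: (leqP n #|V|.+1) => nV; last by lia.
  apply: nmin; rewrite n2 nV andbT /=.
  by apply/existsP; exists (Ordinal jn); rewrite /= E.
congr EFin; under eq_bigr do rewrite indicE nh.
rewrite -natr_sum; congr (_%:R).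
rewrite -(big_mkord xpredT (fun i => nat_of_bool (i < n0)%N)) (@big_cat_nat _ _ _ n0) //=; last exact: leqW.
rewrite [X in (_ + X)%N](_ : _ = 0%N) ?addn0; last first.
  by rewrite big_nat big1 // => i /andP[h _]; rewrite ltnNge h.
rewrite big_nat (eq_bigr (fun=> 1%N)); last by move=> i /andP[_ ->].
by rewrite -big_nat sum_nat_const_nat subn0 muln1.
Qed.

Lemma expected_time_le :
  (expected_self_intersection_time P X <=
   (2 + \sum_v uniform_mass R (nbhd e u) v * \sum_(k < #|V|.+1) selfavoid R e k (u, v))%:E)%E.
Proof.
rewrite /expected_self_intersection_time.
have -> : (\int[P]_w self_intersection_time R X w)%E =
   (\int[P]_w (\sum_(n < #|V|.+2) (\1_(no_return n) w)%:E))%E.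
  by apply: eq_integral => w _; rewrite time_sum sumEFin.
rewrite ge0_integral_sum //; last first.
  by move=> n; apply/measurable_EFinP; exact/measurable_indic/measurable_no_return.
rewrite (eq_bigr (fun n : 'I_(#|V|.+2) => (pr (no_return n))%:E)); last first.
  move=> n _; rewrite integral_indic ?setIT ?prE //; exact: measurable_no_return.
rewrite sumEFin lee_fin big_ord_recl; apply: lerD.
  apply: (@le_trans _ _ 1); last by rewrite ler1n.
  by rewrite -lee_fin prE ?probability_le1 //; exact: measurable_no_return.
under [leRHS]eq_bigr do rewrite mulr_sumr.
rewrite exchange_big /=; apply: ler_sum => k _; exact: pr_no_return.
Qed.

End Law.

(** * The bound on the expected time *)

Lemma expected_time_sqrt (R : realType) (Delta : nat) (V : finType) (e : rel V) (u : V) :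
  symmetric e -> (forall x, (3 <= degree e x)%N) -> (forall x, (degree e x <= Delta)%N) ->
  forall (d : measure_display) (Omega : measurableType d)
             (P : probability Omega R) (X : nat -> Omega -> V),
        nonbacktracking_walk P X e u ->
   (expected_self_intersection_time P X <=
     ((2 + (20 * Delta%:R + 6) * (128 * (Delta + 3)%:R)) * Num.sqrt #|V|%:R)%:E)%E.
Proof.
move=> e_sym deg3 degD d Omega P X nbw.
apply: le_trans (expected_time_le nbw) _; rewrite lee_fin.
have V1 : (1 <= #|V|%:R :> R).
  by rewrite ler1n; apply/card_gt0P; exists u.
set r := Num.sqrt #|V|%:R.
have r1 : 1 <= r by rewrite -[1]sqrtr1 ler_sqrt // ltr01.
have rr : r ^+ 2 = #|V|%:R by rewrite sqr_sqrtr // ler0n.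
set D := Delta%:R.
have D3 : 3 <= D by rewrite /D ler_nat; apply: leq_trans (deg3 u) (degD u).
(* The least natural number above 4 Delta sqrt n, so that m^2 > 16 n Delta. *)
pose m := (Num.truncn (4 * D * r)).+1.
have y0 : 0 <= 4 * D * r by rewrite !mulr_ge0 //; lra.
have m1 : 4 * D * r < m%:R by exact: truncnS_gt.
have m2 : m%:R <= 4 * D * r + 1.
  by rewrite /m -natr1 lerD2r truncn_le.
have hm : (16 * (#|V| * Delta) < m ^ 2)%N.
  rewrite -(ltr_nat R) natrX !natrM -rr -/D.
  have h : (4 * D * r) ^+ 2 < m%:R ^+ 2 by rewrite ltr_pXn2r // nnegrE ?ler0n.
  apply: le_lt_trans h; rewrite !exprMn.
  have : 0 <= r ^+ 2 by exact: sqr_ge0.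
  nra.
set eps : R := (128 * (Delta + 3)%:R)^-1.
have D30 : 0 < (Delta + 3)%:R :> R by rewrite ltr0n addn3.
have eps0 : 0 < eps by rewrite invr_gt0 mulr_gt0.
have hs v : v \in nbhd e u -> \sum_(k < #|V|.+1) selfavoid R e k (u, v) <= (5 * m + 1)%:R / eps.
  move=> uv; apply: (selfavoid_sum deg3) => //.
  - move=> b vb; exact: (selfavoid_bound R e_sym deg3 degD _ vb hm).
  - by move: uv; rewrite inE.
have hsum : \sum_v uniform_mass R (nbhd e u) v * \sum_(k < #|V|.+1) selfavoid R e k (u, v) <=
    (5 * m + 1)%:R / eps.
  apply: (@le_trans _ _ (\sum_v uniform_mass R (nbhd e u) v * ((5 * m + 1)%:R / eps))).
    apply: ler_sum => v _; rewrite /uniform_mass.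
    case: (boolP (v \in _)) => uv; last by rewrite !mul0r.
    by rewrite ler_wpM2l ?hs // divr_ge0 ?ler0n.
  rewrite -mulr_suml /uniform_mass -mulr_suml -natr_sum.
  have -> : (\sum_i (i \in nbhd e u))%N = #|nbhd e u|.
    by rewrite -sum1_card [RHS]big_mkcond; apply: eq_bigr => v _; case: (_ \in _).
  rewrite divff ?mul1r // pnatr_eq0; have := deg3 u; rewrite /degree; by case: #|_|.
apply: le_trans (_ : 2 + (20 * D * r + 6) / eps <= _).
  rewrite lerD2l; apply: le_trans hsum _.
  apply: ler_wpM2r; first by rewrite invr_ge0 ltW.
  have -> : (5 * m + 1)%:R = 5 * m%:R + 1 :> R by rewrite natrD natrM.
  lra.
rewrite [leRHS]mulrDl; apply: lerD; first lra.
rewrite /eps invrK [leRHS]mulrAC; apply: ler_wpM2r; first by rewrite mulr_ge0 // ltW.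
by rewrite [leRHS]mulrDl; lra.
Qed.

Theorem theorem1 (R : realType) (Delta : nat) (hDelta : (3 <= Delta)%N) :
  exists C : R,
    forall (n : nat) (V : finType) (e : rel V) (u : V),
      #|V| = n ->
      simple_graph e ->
      connected_graph e ->
      (forall x : V, (3 <= degree e x)%N) ->
      max_degree e = Delta ->
      forall (d : measure_display) (Omega : measurableType d)
             (P : probability Omega R) (X : nat -> Omega -> V),
        nonbacktracking_walk P X e u ->
        (expected_self_intersection_time P X
           <= (C * Num.sqrt n%:R * ln n%:R)%:E)%E.
Proof.
set K : R := 2 + (20 * Delta%:R + 6) * (128 * (Delta + 3)%:R).
have K0 : 0 <= K by rewrite addr_ge0 ?mulr_ge0 ?addr_ge0 ?mulr_ge0 ?ler0n.
have l2 : 0 < ln 2 :> R by rewrite ln_gt0 // ltr1n.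
exists (K / ln 2) => n V e u Vn [e_sym _] _ deg3 maxD d Omega P X nbw.
have degD x : (degree e x <= Delta)%N by rewrite -maxD; exact: leq_bigmax.
apply: le_trans (expected_time_sqrt e_sym deg3 degD nbw) _; rewrite -/K Vn lee_fin.
have n2 : (2 <= n)%N.
  rewrite -Vn; apply: leq_trans (max_card (mem (nbhd e u))).
  by apply: leq_trans (deg3 u).
rewrite mulrAC ler_wpM2r ?sqrtr_ge0 // -mulrA ler_peMr //.
rewrite mulrC ler_pdivlMr // mul1r ler_ln ?posrE ?ltr0n ?ler_nat //.
by apply: leq_trans n2.
Qed.
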